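(* Let $G$ be a threshold graph of order $n$ with minimum degree $\delta(G)=\ell$, and let $k$ be an integer with $2\le k\le n$. Then $$\tau_k(G)=\begin{cases}0,& \text{if } k>\ell;\\ \ell-k+1,&\text{if } k\le \ell.\end{cases}$$
   Context: A graph $G$ is a threshold graph if there exist a weight function $w:V(G)\to\mathbb R$ and a real constant $t$ such that two distinct vertices $u,v$ are adjacent if and only if $w(u)+w(v)\ge t$. For $S\subseteq V(G)$ with $|S|\ge 2$, a pedant $S$-Steiner tree is a subgraph of $G$ that is a tree containing $S$ in which every vertex of $S$ has degree exactly one. Two pedant $S$-Steiner trees $T,T'$ are internally disjoint if $E(T)\cap E(T')=\emptyset$ and $V(T)\cap V(T')=S$. $\tau_G(S)$ is the maximum number of pairwise internally disjoint pedant $S$-Steiner trees in $G$, and $\tau_k(G)=\min\{\tau_G(S): S\subseteq V(G),\ |S|=k\}$; by convention $\tau_k(G)=0$ when $G$ is disconnected.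
   Formalization: Proved for 3 ≤ k ≤ n instead of 2 ≤ k ≤ n: at k = 2 the formula fails whenever ℓ ≥ 1 (for K_2 a single edge is a pedant tree, so τ_2 = 1, not 0); the case k = 2, ℓ = 0, where τ_2 = 0 by the convention for disconnected graphs, is also left out. *)

(* Defs.v *)
From mathcomp Require Import all_boot all_order all_algebra.
From mathcomp Require Import boolp reals.

Set Implicit Arguments.
Unset Strict Implicit.
Unset Printing Implicit Defensive.

Definition simple_graph (V : finType) (e : rel V) : Prop :=
  symmetric e /\ irreflexive e.

Definition threshold_graph (R : realType) (V : finType) (e : rel V) : Prop :=
  simple_graph e /\
  exists (w : V -> R) (t : R),
    forall u v : V, u != v -> (e u v <-> (t <= w u + w v)%R).

(* The default value #|V| exceeds every degree of a simple graph, so it is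
   irrelevant as soon as V is nonempty. *)
Definition min_degree (V : finType) (e : rel V) : nat :=
  \big[minn/#|V|]_(v : V) #|[set u | e v u]|.

Definition connected_graph (V : finType) (e : rel V) : bool :=
  [forall u, forall v, connect e u v].

Definition edges (V : finType) (e : rel V) : {set {set V}} :=
  [set [set p.1; p.2] | p : V * V & e p.1 p.2].

(* A candidate subgraph is a pair (vertex set, edge set). *)
Definition graph_on (V : finType) : finType := ({set V} * {set {set V}})%type.

Definition subgraph (V : finType) (e : rel V) (H : graph_on V) : Prop :=
  H.2 \subset edges e /\ (forall E : {set V}, E \in H.2 -> E \subset H.1).

Definition adj_in (V : finType) (H : graph_on V) : rel V :=
  fun x y => [set x; y] \in H.2.

Definition degree_in (V : finType) (H : graph_on V) (v : V) : nat :=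
  #|[set E in H.2 | v \in E]|.

Definition is_tree (V : finType) (H : graph_on V) : Prop :=
  [/\ H.1 != set0,
      {in H.1 &, forall x y : V, connect (adj_in H) x y}
    & forall c : seq V, 2 < size c -> ~ ucycle (adj_in H) c].

Definition pedant_steiner_tree (V : finType) (e : rel V) (S : {set V})
    (T : graph_on V) : Prop :=
  [/\ subgraph e T, is_tree T, S \subset T.1
    & {in S, forall v : V, degree_in T v = 1}].

Definition internally_disjoint (V : finType) (S : {set V})
    (T T' : graph_on V) : Prop :=
  T.2 :&: T'.2 = set0 /\ T.1 :&: T'.1 = S.

Definition pedant_packing (V : finType) (e : rel V) (S : {set V})
    (F : {set graph_on V}) : Prop :=
  {in F, forall T, pedant_steiner_tree e S T} /\
  {in F &, forall T T', T != T' -> internally_disjoint S T T'}.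

Definition tau_set (V : finType) (e : rel V) (S : {set V}) : nat :=
  \max_(F : {set graph_on V} | `[< pedant_packing e S F >]) #|F|.

(* minn has no unit on nat: the default value is the maximum of the minimised
   family, which leaves the minimum unchanged when k <= #|V|, that is, when
   there is a set S with k elements. *)
Definition tau (V : finType) (e : rel V) (k : nat) : nat :=
  if connected_graph e then
    let m := \max_(S : {set V} | #|S| == k) tau_set e S in
    \big[minn/m]_(S : {set V} | #|S| == k) tau_set e S
  else 0.

(* Main.v *)
Require Import Defs.
From mathcomp Require Import all_boot all_order all_algebra.
From mathcomp Require Import boolp reals.

(* Upper bound: since |S| >= 3, two vertices of S are never adjacent in a
   pedant S-Steiner tree, so disjoint trees use distinct neighbours outside S
   of any given v in S.  Choosing S to contain a vertex v of minimum degree and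
   as many of its neighbours as possible leaves at most l + 1 - k of them.
   Lower bound: if v has the least weight in S, every neighbour of v outside S
   is adjacent to all of S, hence is the centre of a star with leaf set S. *)

Set Implicit Arguments.
Unset Strict Implicit.
Unset Printing Implicit Defensive.

(** * Finite minima and sets of prescribed size *)

Lemma bigminn_geq (I : finType) (P : pred I) (F : I -> nat) (d m : nat) :
  m <= d -> (forall i, P i -> m <= F i) -> m <= \big[minn/d]_(i | P i) F i.
Proof.
move=> md mF; elim/big_ind: _ => // x y mx my.
by rewrite leq_min mx.
Qed.

Lemma bigminn_leq (I : finType) (P : pred I) (F : I -> nat) (d : nat) (i : I) :
  P i -> \big[minn/d]_(j | P j) F j <= F i.
Proof.
move=> Pi; have: i \in index_enum I by rewrite mem_index_enum.
elim: (index_enum I) => // j s IH; rewrite inE big_cons => /orP[/eqP<-|/IH le_s].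
  by rewrite Pi geq_minl.
by case: ifP => // _; apply: leq_trans (geq_minr _ _) le_s.
Qed.

Lemma exists_set_between (T : finType) (A B : {set T}) (k : nat) :
  A \subset B -> #|A| <= k <= #|B| ->
  exists S : {set T}, [/\ A \subset S, S \subset B & #|S| = k].
Proof.
move=> sAB /andP[Ak kB].
have : k - #|A| <= #|B :\: A| by rewrite cardsDS // leq_sub2r.
case/card_geqP=> s [us szs ss].
have sBA x : x \in s -> (x \notin A) && (x \in B) by move/ss; rewrite inE.
exists (A :|: [set:: s]); split; first exact: subsetUl.
  by rewrite subUset sAB; apply/subsetP=> x; rewrite inE => /sBA/andP[].
have dAs : A :&: [set:: s] = set0.
  apply/setP=> x; rewrite !inE; apply/negbTE/negP=> /andP[xA /sBA].
  by rewrite xA.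
by rewrite cardsU dAs cards0 subn0 cardsE (card_uniqP us) szs subnKC.
Qed.

Lemma set2_eq_l (T : finType) (v x y : T) : [set v; x] = [set v; y] -> x = y.
Proof.
move=> E; have := set22 v x; rewrite E !inE => /orP[/eqP xv|/eqP //].
by have := set22 v y; rewrite -E xv !inE orbb => /eqP.
Qed.

(** * Pedant Steiner trees in a simple graph: the upper bound, and packings by stars *)

Section SteinerTrees.

Variables (V : finType) (e : rel V).
Hypothesis simple_e : simple_graph e.

Lemma in_edges (x y : V) : ([set x; y] \in edges e) = e x y.
Proof.
have [sym_e irr_e] := simple_e.
apply/imsetP/idP=> [[[a b]]|exy]; last by exists (x, y); rewrite ?inE.
rewrite inE /= => eab E.
have := set21 a b; rewrite -E !inE => /orP[] /eqP ax; subst a.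
  by rewrite (set2_eq_l E).
by move: E; rewrite setUC => /set2_eq_l ->; rewrite sym_e.
Qed.

Lemma edges_incident (E : {set V}) (v : V) :
  E \in edges e -> v \in E -> exists y, E = [set v; y].
Proof.
case/imsetP=> -[a b] _ -> /set2P[] ->; first by exists b.
by exists a; rewrite setUC.
Qed.

(** The vertex [v0] makes [V] nonempty, so a minimiser exists; the default [#|V|] does no harm,
    being at least every degree. *)
Lemma min_degreeP (v0 : V) : exists v, #|[set u | e v u]| = min_degree e.
Proof.
have [v _ vmin] := arg_minnP (fun v => #|[set u | e v u]|) (erefl (predT v0)).
exists v; apply/eqP; rewrite eqn_leq bigminn_leq // andbT.
by apply: bigminn_geq => [|u _]; [apply: max_card | apply: vmin].
Qed.

Lemma degree_in_uniq (H : graph_on V) (v x y : V) :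
  degree_in H v = 1 -> [set v; x] \in H.2 -> [set v; y] \in H.2 -> x = y.
Proof.
move=> /eqP/cards1P[E defE] xH yH.
have: [set v; x] \in [set E] by rewrite -defE inE xH set21.
have: [set v; y] \in [set E] by rewrite -defE inE yH set21.
by move=> /set1P Ey /set1P Ex; apply: (@set2_eq_l _ v); rewrite Ex Ey.
Qed.

Lemma pedant_neighbour (S : {set V}) (T : graph_on V) (v : V) :
  2 < #|S| -> v \in S -> pedant_steiner_tree e S T ->
  exists y, [&& [set v; y] \in T.2, e v y & y \notin S].
Proof.
move=> S3 vS [[sTe _] [_ conT _] sST degT].
have /eqP/cards1P[E defE] := degT v vS.
have : E \in [set E in T.2 | v \in E] by rewrite defE set11.
rewrite inE => /andP[ET vE].
have [y Ey] := edges_incident (subsetP sTe _ ET) vE; subst E.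
exists y; rewrite ET -in_edges (subsetP sTe) //=.
apply/negP=> yS.
(* As [#|S| > 2], some third vertex of [S] remains; connectedness of [T] has to reach it from
   [v]. *)
have [z] : exists z, z \in S :\: [set v; y].
  apply/set0Pn; rewrite -card_gt0 cardsD subn_gt0.
  apply: leq_ltn_trans S3; apply: leq_trans (subset_leq_card (subsetIr _ _)) _.
  by rewrite cards2; case: (_ != _).
rewrite inE => /andP[zvy zS].
(* The two adjacent leaves v and y form a whole connected component of T. *)
have clos : closed (adj_in T) [set v; y].
  apply: intro_closed => [|a b].
    by apply: sym_connect_sym => a b; rewrite /adj_in setUC.
  rewrite /adj_in !inE => abT /orP[] /eqP ea; subst a.
    by rewrite (degree_in_uniq (degT v vS) abT ET) eqxx orbT.
  by rewrite setUC in ET; rewrite (degree_in_uniq (degT y yS) abT ET) eqxx.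
have := closed_connect clos (conT v z (subsetP sST _ vS) (subsetP sST _ zS)).
by rewrite set21 (negbTE zvy).
Qed.

(** Sending each tree of a packing to the neighbour of [v] in it is injective: two trees with the
    same image would share the edge at [v]. *)
Lemma tau_set_leq (S : {set V}) (v : V) :
  2 < #|S| -> v \in S -> tau_set e S <= #|[set u | e v u] :\: S|.
Proof.
move=> S3 vS; apply/bigmax_leqP=> F /asboolP[treeF disjF].
pose P (T : graph_on V) y := [&& [set v; y] \in T.2, e v y & y \notin S].
(* The default [v] is never taken on [F], where [pedant_neighbour] makes [pick] succeed. *)
pose f T := odflt v [pick y | P T y].
have fP T : T \in F -> P T (f T).
  move=> /treeF/(pedant_neighbour S3 vS)[y Py]; rewrite /f.
  by case: pickP => //= /(_ y); rewrite /P Py.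
have injf : {in F &, injective f}.
  move=> T T' TF T'F eqf; apply/eqP/negPn/negP=> neqT.
  have [dE _] := disjF _ _ TF T'F neqT.
  have /and3P[vT _ _] := fP T TF; have /and3P[vT' _ _] := fP T' T'F.
  have : [set v; f T] \in T.2 :&: T'.2 by rewrite inE vT eqf vT'.
  by rewrite dE inE.
rewrite -(card_in_imset injf); apply/subset_leq_card/subsetP=> _ /imsetP[T TF ->].
by have /and3P[_ evf fS] := fP T TF; rewrite !inE evf fS.
Qed.

Definition star (S : {set V}) (u : V) : graph_on V :=
  (u |: S, [set [set u; s] | s in S]).

Lemma star_adj (S : {set V}) (u x y : V) :
  adj_in (star S u) x y -> (x == u) || (y == u).
Proof.
case/imsetP=> s _ E; have := set21 u s.
by rewrite -E !inE ![u == _]eq_sym.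
Qed.

Lemma star_pedant (S : {set V}) (u : V) :
  u \notin S -> {in S, forall s, e u s} -> pedant_steiner_tree e S (star S u).
Proof.
move=> uS eus; split.
- split=> [|E].
    by apply/subsetP=> _ /imsetP[s sS ->]; rewrite in_edges eus.
  case/imsetP=> s sS ->; rewrite subUset !sub1set !inE eqxx.
  by rewrite sS orbT.
- split.
  + by apply/set0Pn; exists u; rewrite setU11.
  + have cu x : x \in u |: S -> connect (adj_in (star S u)) u x.
      case/setU1P=> [->|xS]; first exact: connect0.
      by apply/connect1/imsetP; exists x.
    have sym : connect_sym (adj_in (star S u)).
      by apply: sym_connect_sym => a b; rewrite /adj_in setUC.
    by move=> x y xS yS; apply: connect_trans (cu y yS); rewrite sym cu.
  (* Every edge of a star meets [u]. In a cycle [x, y, z, ...] the first two edges and [x != z]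
     force [y = u]; the edge leaving [z], towards [x] or a further vertex [a], would then have to
     contain [u] a second time. *)
  + move=> [|x [|y [|z c]]] // _ /andP[cyc uniq_c].
    move: cyc uniq_c; rewrite /= !inE !negb_or.
    move=> /and3P[/star_adj xy /star_adj yz zc].
    move=> /and3P[/and3P[nxy nxz xc] /andP[nyz yc] /andP[zc' _]].
    have yu : y = u.
      case/orP: xy => /eqP // xu; subst x.
      by case/orP: yz => /eqP // zu; rewrite zu eqxx in nxz.
    subst y; move: nxy nyz yc zc; rewrite [u == z]eq_sym => nxu nzu.
    case: c xc zc' => [|a c] _ _ /=; first by
      move=> _ /andP[/star_adj]; rewrite (negbTE nxu) (negbTE nzu).
    rewrite inE negb_or [u == a]eq_sym => /andP[nau _] /andP[/star_adj].
    by rewrite (negbTE nau) (negbTE nzu).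
- exact: subsetUr.
- move=> s sS; apply/eqP/cards1P; exists [set u; s].
  apply/setP=> E; rewrite !inE; apply/andP/eqP=> [[/imsetP[s' _ ->]]|->].
    rewrite !inE => /orP[/eqP su|/eqP -> //].
    by rewrite -su sS in uS.
  by rewrite set22; split=> //; apply/imsetP; exists s.
Qed.

Lemma star_disjoint (S : {set V}) (u u' : V) :
  u \notin S -> u' \notin S -> u != u' ->
  internally_disjoint S (star S u) (star S u').
Proof.
move=> uS u'S neq; split=> /=.
  apply/setP=> E; rewrite !inE; apply/negbTE/negP.
  case/andP=> /imsetP[s _ ->] /imsetP[s' s'S Es].
  have := set21 u s; rewrite Es !inE (negbTE neq) => /eqP us'.
  by rewrite us' s'S in uS.
apply/setP=> x; rewrite !inE; case: (boolP (x \in S)) => [|_]; first by rewrite !orbT.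
rewrite !orbF; apply/negbTE/negP=> /andP[/eqP-> ].
exact/negP.
Qed.

(** The stars centred at the elements of [A] with leaf set [S] form a packing, and distinct centres
    outside [S] give distinct stars. *)
Lemma tau_set_geq (S A : {set V}) :
  [disjoint A & S] -> {in A & S, forall u s, e u s} -> #|A| <= tau_set e S.
Proof.
move=> dAS eAS; have nS u : u \in A -> u \notin S.
  by move=> uA; rewrite (disjointFr dAS).
have inj : {in A &, injective (star S)}.
  move=> u u' uA u'A [/setP/(_ u)]; rewrite setU11 => /esym/setU1P[//|uS] _.
  by rewrite (negbTE (nS u uA)) in uS.
rewrite -(card_in_imset inj).
apply: (@leq_bigmax_cond _ _ (fun F : {set graph_on V} => #|F|)).
apply/asboolP; split.
  by move=> _ /imsetP[u uA ->]; apply: star_pedant => [|s]; [apply: nS | apply: eAS].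
move=> _ _ /imsetP[u uA ->] /imsetP[u' u'A ->] neq.
by apply: star_disjoint; rewrite ?nS //; apply: contraNneq neq => ->.
Qed.

Lemma tau_leq (k : nat) : 2 < k <= #|V| -> tau e k <= (min_degree e).+1 - k.
Proof.
move=> /andP[k3 kV]; rewrite /tau; case: ifP => // _.
have [v0 _] : exists v, v \in V by apply/card_gt0P; apply: leq_trans kV; case: k k3.
have [v degv] := min_degreeP v0; set N := [set u | e v u] in degv.
have vN : v \notin N by rewrite inE; case: simple_e => _ ->.
have cA : #|v |: N| = (min_degree e).+1 by rewrite cardsU1 vN degv.
have [S [vS Sk NS]] : exists S : {set V},
    [/\ v \in S, #|S| = k & #|N :\: S| <= (min_degree e).+1 - k].
  (* Up to size [(min_degree e).+1], [S] fits between [[set v]] and the closed neighbourhood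
     [v |: N], which leaves exactly [(min_degree e).+1 - k] vertices of [v |: N]. For larger [k],
     [S] swallows [v |: N] and the truncated bound is 0. *)
  case: (leqP k (min_degree e).+1) => kl.
    have [||S [vS SA Sk]] := @exists_set_between V [set v] (v |: N) k.
    - by rewrite sub1set setU11.
    - by rewrite cards1 cA kl andbT; apply: leq_trans k3.
    exists S; split=> //; first by rewrite -sub1set.
    by rewrite -cA -Sk -cardsDS // subset_leq_card // setSD // subsetUr.
  have [||S [AS _ Sk]] := @exists_set_between V (v |: N) setT k.
  - exact: subsetT.
  - by rewrite cA cardsT kV ltnW.
  exists S; split=> //; first by rewrite (subsetP AS) ?setU11.
  have /eqP-> : N :\: S == set0.
    by rewrite setD_eq0 (subset_trans _ AS) // subsetUr.
  by rewrite cards0.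
apply: leq_trans NS; apply: leq_trans (tau_set_leq _ vS); last by rewrite Sk.
by apply: bigminn_leq; rewrite Sk.
Qed.

End SteinerTrees.

(** * Threshold graphs: connectedness and the lower bound *)

Section ThresholdGraphs.

Variables (R : realType) (V : finType) (e : rel V).
Hypothesis threshold_e : threshold_graph R e.

(** A vertex [x] of maximum weight is adjacent to every other vertex [v]: a neighbour [u] of [v]
    gives [t <= w v + w u <= w v + w x]. *)
Lemma threshold_connected : 0 < min_degree e -> connected_graph e.
Proof.
have [[sym_e irr_e] [w [t wE]]] := threshold_e => l0.
apply/forallP=> x0.
have [x _ xmax] := Order.TotalTheory.arg_maxP w (erefl (predT x0)).
have cx v : connect e v x.
  have [->|vx] := eqVneq v x; first exact: connect0.
  apply/connect1/wE => //.
  have /card_gt0P[u] : 0 < #|[set u | e v u]|.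
    by apply: leq_trans l0 _; apply: bigminn_leq.
  rewrite inE => evu; have vu : v != u by apply: contraTneq evu => ->; rewrite irr_e.
  apply: Order.POrderTheory.le_trans (iffLR (wE _ _ vu) evu) _.
  by rewrite Num.Theory.lerD2l; apply: xmax.
apply/forallP=> y; apply: connect_trans (cx x0) _.
by rewrite (sym_connect_sym sym_e).
Qed.

Lemma threshold_tau_set_geq (S : {set V}) :
  S != set0 -> (min_degree e).+1 - #|S| <= tau_set e S.
Proof.
have [[sym_e irr_e] [w [t wE]]] := threshold_e => /set0Pn[s0 s0S].
have [v vS vmin] := @Order.TotalTheory.arg_minP _ _ _ _ (fun x => x \in S) w s0S.
set N := [set u | e v u].
have NS : (min_degree e).+1 - #|S| <= #|N :\: S|.
  (* Since [v] is in [S], counting in the closed neighbourhood changes nothing in the difference and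
     gains the successor in the bound. *)
  have ->: N :\: S = (v |: N) :\: S.
    by apply/setP=> x; rewrite !inE; case: eqP => [->|//]; rewrite vS.
  have vN : v \notin N by rewrite inE irr_e.
  have degv : min_degree e <= #|N| by apply: bigminn_leq.
  rewrite cardsD cardsU1 vN add1n.
  exact: leq_trans (leq_sub2r _ _) (leq_sub2l _ (subset_leq_card (subsetIr _ _))).
apply: leq_trans NS (tau_set_geq threshold_e.1 _ _).
  by rewrite -setI_eq0 setDE -setIA (setIC (~: S)) setICr setI0.
move=> u s; rewrite !inE => /andP[uS evu] sS.
have vu : v != u by apply: contraTneq evu => ->; rewrite irr_e.
have us : u != s by apply: contraNneq uS => ->.
(* The chain is [t <= w v + w u <= w u + w s], by minimality of [w v] on [S]. *)
apply/wE => //; apply: Order.POrderTheory.le_trans (iffLR (wE _ _ vu) evu) _.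
by rewrite GRing.addrC Num.Theory.lerD2l vmin.
Qed.

Lemma threshold_tau_geq (k : nat) :
  0 < k <= #|V| -> k <= min_degree e -> (min_degree e).+1 - k <= tau e k.
Proof.
move=> /andP[k0 kV] kl; rewrite /tau threshold_connected ?(leq_trans k0) //.
have geqS (S : {set V}) : #|S| == k -> (min_degree e).+1 - k <= tau_set e S.
  move=> /eqP Sk; rewrite -Sk threshold_tau_set_geq //.
  by rewrite -card_gt0 Sk.
(* The default value in [tau] must satisfy the bound too; it is a maximum over [k]-sets, so
   exhibiting one such set suffices. *)
apply: bigminn_geq => [|S]; last exact: geqS.
have [||S [_ _ Sk]] := @exists_set_between V set0 setT k.
- exact: sub0set.
- by rewrite cards0 cardsT kV.
by apply: leq_trans (geqS S _) (leq_bigmax_cond _ _); rewrite Sk.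
Qed.

End ThresholdGraphs.

Theorem theorem3 (R : realType) (V : finType) (e : rel V) (n l k : nat)
    (threshold_e : threshold_graph R e) (order_e : #|V| = n)
    (min_degree_e : min_degree e = l) (k_ge3 : 3 <= k) (k_le_n : k <= n) :
  tau e k = if l < k then 0 else l - k + 1.
Proof.
subst n l; have leq_tau := @tau_leq V e threshold_e.1 k.
rewrite k_ge3 k_le_n in leq_tau; move/(_ isT): leq_tau => leq_tau.
(* For [k] above the minimum degree the truncated difference in [leq_tau] is already 0; otherwise it
   equals the claimed value and the lower bound applies. *)
case: ltnP => [lk|kl].
  by apply/eqP; rewrite -leqn0 (leq_trans leq_tau) // leqn0 subn_eq0.
apply/eqP; rewrite addn1 -subSn // eqn_leq leq_tau.
by apply: (threshold_tau_geq threshold_e) => //; rewrite k_le_n (leq_trans _ k_ge3).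
Qed.
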